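(* Let $\alpha\in\mathbb{C}$ and let $S\subset\mathbb{C}$ be a finite set such that $\mathbb{Z}[\alpha]=S[\alpha]$. Then $\alpha$ is an algebraic number (so $M_\alpha$ is defined), and each element of $S$ lies in $\mathbb{Z}[\alpha]$. Fix, for each element of $S$, a representation of it as an integer polynomial evaluated at $\alpha$, and let $s$ be the greatest exponent of $\alpha$ occurring in these fixed representations. Then there is a finite set $F\subset\mathbb{Z}$ such that $\mathbb{Z}[\alpha]=F[\alpha]$ and \[ \operatorname{Card}(F)\leq \operatorname{Card}(S)\,\frac{\operatorname{Card}(S)^{s+1}-1}{\operatorname{Card}(S)-1}. \] Moreover, $\operatorname{Card}(S)\geq 2$, and $S$ contains at least $|M_\alpha(0)|$ elements of the form $P_j(\alpha)$, $j\in\{0,\ldots,|M_\alpha(0)|-1\}$, where $P_j\in\mathbb{Z}[x]$ and $P_j(0)\equiv j \pmod{M_\alpha(0)}$.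
   Context: For a set $S\subset\mathbb{C}$ and $\alpha\in\mathbb{C}$, $S[\alpha]:=\{\sum_{j=0}^n f_j\alpha^j : n\in\mathbb{N},\ (f_0,\ldots,f_n)\in S^{n+1}\}$. For an algebraic number $\alpha$, $M_\alpha\in\mathbb{Z}[x]$ denotes its minimal polynomial over $\mathbb{Q}$, normalized to be primitive (integer coefficients with greatest common divisor $1$). *)

(* Defs.v *)
From HB Require Import structures.
From mathcomp Require Import all_boot all_order all_algebra.
From mathcomp Require Import finmap.
From mathcomp Require Import all_classical all_reals.
From mathcomp Require Import complex.

Set Implicit Arguments.
Unset Strict Implicit.
Unset Printing Implicit Defensive.

Import Order.TTheory GRing.Theory Num.Theory.

Local Open Scope classical_set_scope.
Local Open Scope ring_scope.

(* The set S[a]; it is Z[a] for S = int_set and F[a] for S = intr @` F. *)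
Definition digit_expansions (C : nzRingType) (S : set C) (a : C) : set C :=
  [set z | exists (n : nat) (f : 'I_n.+1 -> C),
     (forall j, S (f j)) /\ z = \sum_(j < n.+1) f j * a ^+ j].

Definition int_set {C : nzRingType} : set C := range (fun m : int => m%:~R).

Definition evalZ (C : nzRingType) (p : {poly int}) (a : C) : C :=
  (map_poly intr p).[a].

(* The absolute value is there because zcontents carries the sign of the
   leading coefficient: the primitive minimal polynomial over the rationals is
   determined up to sign only. Note that zcontents 0 = 0, so M is nonzero. *)
Definition is_primitive_minpoly (C : unitRingType) (a : C) (M : {poly int}) :=
  [/\ `|zcontents M| = 1,
      evalZ M a = 0 &
      forall q : {poly rat}, q != 0 -> root (map_poly ratr q) a ->
        (size M <= size q)%N].

Lemma primitive_minpoly_exists (C : numFieldType) (a : C) :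
  algebraicOver (ratr : rat -> C) a -> exists M, is_primitive_minpoly a M.
Proof.
case=> p0 nz_p0 p0a.
pose Q n := `[< exists q : {poly rat},
  [/\ q != 0, root (map_poly ratr q) a & size q = n] >].
have exQ : exists n, Q n by exists (size p0); apply/asboolP; exists p0.
case: (ex_minnP exQ) => n /asboolP[q [nz_q qa sq]] minn.
have [p [c nz_c Dq]] := rat_poly_scale q.
have nz_p : p != 0.
  by apply: contraNneq nz_q => p0'; rewrite Dq p0' rmorph0 scaler0.
exists (zprimitive p); split.
- by rewrite zcontents_primitive nz_p.
- move: qa; rewrite /root Dq map_polyZ hornerZ mulf_eq0 fmorph_eq0.
  rewrite invr_eq0 intr_eq0 (negPf nz_c) /= -map_poly_comp.
  rewrite (eq_map_poly (g := intr)); last by move=> m /=; rewrite ratr_int.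
  rewrite {1}[p]zpolyEprim map_polyZ /= hornerZ mulf_eq0 intr_eq0 zcontents_eq0.
  by rewrite (negPf nz_p) => /eqP.
- move=> r nz_r ra; rewrite size_zprimitive.
  have -> : size p = size q.
    rewrite Dq size_scale ?invr_eq0 ?intr_eq0 //.
    by rewrite size_map_inj_poly //; exact: intr_inj.
  by rewrite sq; apply: minn; apply/asboolP; exists r.
Qed.

Lemma primitive_minpoly_unique (C : numFieldType) (a : C) (M N : {poly int}) :
  is_primitive_minpoly a M -> is_primitive_minpoly a N -> M = N \/ M = - N.
Proof.
have ratE (p : {poly int}) : map_poly ratr (map_poly (intr : int -> rat) p)
    = map_poly (intr : int -> C) p.
  by rewrite -map_poly_comp; apply: eq_map_poly => m /=; rewrite ratr_int.
have szE (p : {poly int}) : size (map_poly (intr : int -> rat) p) = size p.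
  by rewrite size_map_inj_poly //; exact: intr_inj.
have nz (p : {poly int}) : `|zcontents p| = 1 -> p != 0.
  by move=> h; apply: contra_eq_neq h => ->; rewrite zcontents0 normr0 eq_sym oner_neq0.
have le (P Q : {poly int}) : is_primitive_minpoly a P ->
    is_primitive_minpoly a Q -> (size P <= size Q)%N.
  move=> [_ _ minP] [/nz nzQ Qa _]; rewrite -(szE Q); apply: minP.
    by rewrite -size_poly_eq0 szE size_poly_eq0.
  by rewrite ratE; apply/eqP.
move=> hM hN; have sMN : size M = size N.
  by apply/eqP; rewrite eqn_leq !le.
case: (hM) (hN) => cM Ma minM [cN Na _].
have nzM := nz _ cM; have nzN := nz _ cN.
pose D := lead_coef N *: M - lead_coef M *: N.
have D0 : D = 0.
  apply/eqP; apply: contraT => nzD.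
  have : (size M <= size D)%N.
    rewrite -(szE D); apply: minM; first by rewrite -size_poly_eq0 szE size_poly_eq0.
    rewrite ratE /root rmorphB /= !map_polyZ /= hornerD hornerN !hornerZ.
    by move: Ma Na; rewrite /evalZ => -> ->; rewrite !mulr0 subr0.
  rewrite leqNgt => /negP[].
  rewrite [X in (_ < X)%N]polySpred // ltnS; apply/leq_sizeP => j.
  rewrite leq_eqVlt => /orP[/eqP<-|lt_j].
    by rewrite !coefE /= -lead_coefE sMN -lead_coefE mulrC subrr.
  rewrite !coefE [M`_j]nth_default; last by rewrite -[size M]prednK ?size_poly_gt0.
  rewrite [N`_j]nth_default; last by rewrite -sMN -[size M]prednK ?size_poly_gt0.
  by rewrite !mulr0 subr0.
move/eqP: D0; rewrite subr_eq0 => /eqP E.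
have nlM : lead_coef M != 0 by rewrite lead_coef_eq0.
have nlN : lead_coef N != 0 by rewrite lead_coef_eq0.
have Ep : zprimitive M = zprimitive N.
  by rewrite -(zprimitiveZ M nlN) E zprimitiveZ.
rewrite [M]zpolyEprim [N]zpolyEprim Ep.
have sgn (x : int) : `|x| = 1 -> x = 1 \/ x = -1.
  by case: (ger0P x) => _; [left|move=> <-; right; rewrite opprK].
by case: (sgn _ cM) => ->; case: (sgn _ cN) => ->;
  rewrite ?scaleN1r ?scale1r ?opprK; auto.
Qed.

(* Main.v *)
Require Import Defs.
From HB Require Import structures.
From mathcomp Require Import all_boot all_order all_algebra.
From mathcomp Require Import finmap.
From mathcomp Require Import all_classical all_reals.
From mathcomp Require Import complex.

Import Order.TTheory GRing.Theory Num.Theory.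

Local Open Scope classical_set_scope.
Local Open Scope ring_scope.

(** Evaluation at [0] sends Z[a] onto Z/M(0) (onto Z if [a] were
    transcendental) and maps an expansion to the class of its lowest digit, so
    the digits hit every class; as there are finitely many digits, [a] is
    algebraic. A single digit is impossible: an expansion of [0] would make [a] a
    root of unity, leaving finitely many expansions.

    For integer digits, write each digit of an S-expansion [f_0, ..., f_n] as a
    polynomial in [a] of degree at most [s] and collect powers of [a]: the m-th
    coefficient is determined by the window [f_(m-s), ..., f_m]. Truncated
    windows occur at both ends, but the lower ones disappear if [s] fixed
    digits are put in front; this only adds a constant of Z[a] to the represented
    number, so all of Z[a] is still reached. The remaining windows have lengths
    [1, ..., s+1], whence at most [#S + ... + #S^(s+1)] digits. *)

(** Pigeonhole, applied to the digits in [S] and to the values of expansions in a single digit. *)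
Lemma no_injective_nat_in_seq (T : eqType) (f : nat -> T) (s : seq T) :
  injective f -> ~ (forall n, f n \in s).
Proof.
move=> f_inj f_s; have := ltnn (size s); rewrite -[X in (X <= _)%N](size_iota 0).
rewrite -(size_map f) uniq_leq_size ?map_inj_uniq ?iota_uniq //.
by move=> _ /mapP[n _ ->].
Qed.

(** * Evaluation of integer polynomials *)

Section Evaluation.
Variables (C : comNzRingType) (a : C).

Lemma evalZD p q : evalZ (p + q) a = evalZ p a + evalZ q a.
Proof. by rewrite /evalZ rmorphD hornerD. Qed.

Lemma evalZB p q : evalZ (p - q) a = evalZ p a - evalZ q a.
Proof. by rewrite /evalZ rmorphB hornerD hornerN. Qed.

Lemma evalZM p q : evalZ (p * q) a = evalZ p a * evalZ q a.
Proof. by rewrite /evalZ rmorphM hornerM. Qed.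

Lemma evalZC m : evalZ m%:P a = m%:~R.
Proof. by rewrite /evalZ map_polyC hornerC. Qed.

Lemma evalZXn n : evalZ 'X^n a = a ^+ n.
Proof. by rewrite /evalZ map_polyXn hornerXn. Qed.

Lemma evalZ_sum I (r : seq I) (F : I -> {poly int}) :
  evalZ (\sum_(i <- r) F i) a = \sum_(i <- r) evalZ (F i) a.
Proof. by rewrite /evalZ rmorph_sum horner_sum. Qed.

Lemma evalZ_coef_wide n (p : {poly int}) :
  (size p <= n)%N -> evalZ p a = \sum_(i < n) (p`_i)%:~R * a ^+ i.
Proof.
move=> sp; rewrite /evalZ (@horner_coef_wide _ n); last first.
  exact: leq_trans (size_poly _ _) sp.
by apply: eq_bigr => i _; rewrite coef_map.
Qed.

Lemma digit_expansions_intP z :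
  digit_expansions int_set a z <-> exists p, z = evalZ p a.
Proof.
split=> [[n [f [fZ ->]]]|[p ->]].
  have /fin_all_exists[g gE] j : exists m : int, m%:~R = f j.
    by have [m _ <-] := fZ j; exists m.
  exists (\sum_(j < n.+1) (g j)%:P * 'X^j); rewrite evalZ_sum.
  by apply: eq_bigr => j _; rewrite evalZM evalZC evalZXn gE.
exists (size p), (fun j => (p`_j)%:~R); split=> [j|]; first by exists p`_j.
exact: evalZ_coef_wide.
Qed.

Lemma digit_expansions1 (S : set C) x : S x -> digit_expansions S a x.
Proof.
by move=> Sx; exists 0, (fun=> x); rewrite big_ord1 expr0 mulr1.
Qed.

End Evaluation.

(** * Divisibility by the minimal polynomial *)

Lemma evalZ_ratr (C : numFieldType) (a : C) (p : {poly int}) :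
  evalZ p a = (map_poly ratr (map_poly (intr : int -> rat) p)).[a].
Proof.
rewrite /evalZ -map_poly_comp; congr (_.[_]).
by apply: eq_map_poly => m /=; rewrite ratr_int.
Qed.

(** By minimality the remainder of [p] modulo [M] over the rationals is 0. As [M] is primitive,
    Gauss's lemma makes the quotient integral. *)
Lemma primitive_minpoly_dvd (C : numFieldType) (a : C) (M p : {poly int}) :
  is_primitive_minpoly a M -> evalZ p a = 0 -> exists q, p = M * q.
Proof.
move=> [cM Ma minM] pa; pose ratp := map_poly (intr : int -> rat).
have szE q : size (ratp q) = size q by rewrite size_map_inj_poly //; exact: intr_inj.
have M_neq0 : M != 0.
  by apply: contra_eq_neq cM => ->; rewrite zcontents0 normr0 eq_sym oner_neq0.
have : M %| p.
  rewrite -dvdp_rat_int; apply/modp_eq0P/eqP; apply: contraT => nz_r.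
  have := minM _ nz_r; rewrite leqNgt -[X in (_ < X)%N]szE ltn_modpN0; last first.
    by rewrite -size_poly_eq0 szE size_poly_eq0.
  apply; have := congr1 (horner^~ a \o map_poly ratr) (divp_eq (ratp p) (ratp M)).
  rewrite /= rmorphD rmorphM /= hornerD hornerM -!evalZ_ratr pa Ma mulr0 add0r.
  by move=> r0; apply/eqP; rewrite -r0.
(* The quotient obtained is by [zprimitive M]; the sign [zcontents M], whose square is 1, is moved
   into it. *)
case/dvdpP_int=> q ->; exists (zcontents M *: q).
rewrite -scalerAr scalerAl {3}[M]zpolyEprim scalerA -expr2.
by rewrite -real_normK ?num_real // cM expr1n scale1r.
Qed.

(** * Windows of digits *)

(* All sums [c x_0 s + c x_1 (s - 1) + ...] of [n] terms with the [x_t] in [S]. *)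
Fixpoint window_sums {T : Type} (c : T -> nat -> int) (S : seq T) (s n : nat) :
    seq int :=
  if n is m.+1 then [seq c x (s - m)%N + y | x <- S, y <- window_sums c S s m]
  else [:: 0].

Lemma size_window_sums (T : Type) (c : T -> nat -> int) (S : seq T) s n :
  size (window_sums c S s n) = (size S ^ n)%N.
Proof. by elim: n => //= n IH; rewrite size_allpairs IH expnS. Qed.

Lemma mem_window_sums (T : eqType) (c : T -> nat -> int) (S : seq T) s n (g : nat -> T) :
  (forall t, g t \in S) ->
  \sum_(t < n) c (g t) (s - t)%N \in window_sums c S s n.
Proof.
move=> gS; elim: n => [|n IH] /=; first by rewrite big_ord0 mem_seq1.
rewrite big_ord_recr /= addrC.
exact: (allpairs_f (fun x y => c x (s - n)%N + y) (gS n) IH).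
Qed.

(** Only [m <= i <= m + s] contribute: smaller [i] fail by the degree bound, larger ones by the
    factor ['X^i]. Since the exponent is at least [s], a window can be cut only at its upper end. *)
Lemma coef_convolution_window s n m (p : nat -> {poly int}) :
  (forall i, size (p i) <= s.+1)%N ->
  (\sum_(i < s + n.+1) p i * 'X^i)`_(m + s) =
  \sum_(t < minn s.+1 (s + n.+1 - m)) (p (m + t)%N)`_(s - t).
Proof.
move=> sp; rewrite coef_sum; under eq_bigr do rewrite coefMXn.
pose G i := if (m + s < i)%N then 0 else (p i)`_(m + s - i).
rewrite -(big_mkord xpredT G).
have [lt_m|le_m] := ltnP (s + n.+1) m.
  rewrite (_ : _ - m = 0)%N; last by apply/eqP; rewrite subn_eq0 ltnW.
  rewrite minn0 big_ord0 big_nat big1 // => i /andP[_ lt_i].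
  rewrite /G; case: ifP => // _; apply: nth_default; apply: leq_trans (sp i) _.
  by rewrite ltn_subRL ltn_add2r (leq_trans lt_i) // ltnW.
rewrite (big_cat_nat (leq0n m) le_m) /= [X in X + _]big_nat big1 ?add0r; last first.
  move=> i /andP[_ lt_i]; rewrite /G; case: ifP => // _; apply: nth_default.
  by apply: leq_trans (sp i) _; rewrite ltn_subRL ltn_add2r.
rewrite -{1}[m]add0n big_addn.
set k := (s + n.+1 - m)%N; rewrite (big_cat_nat (leq0n (minn s.+1 k)) (geq_minr _ _)) /=.
rewrite [X in _ + X]big_nat [X in _ + X]big1 ?addr0; last first.
  move=> i /andP[]; rewrite geq_min orbC leqNgt => /orP[/negPf->//|lt_i _].
  by rewrite /G [(i + m)%N]addnC ltn_add2l lt_i.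
rewrite big_mkord; apply: eq_bigr => t _.
have le_t : (t <= s)%N by rewrite -ltnS (leq_trans (ltn_ord t)) ?geq_minl.
by rewrite /G [(t + m)%N]addnC ltn_add2l ltnNge le_t /= subnDl.
Qed.

(** * Digit sets [S] with Z[a] = S[a] *)

Section Digits.
Variables (C : numFieldType) (a : C) (S : {fset C}).
Hypothesis hS : digit_expansions int_set a = digit_expansions [set` S] a.

Lemma digits_in_intP x : x \in S -> exists p, evalZ p a = x.
Proof.
move=> Sx; suff /digit_expansions_intP[p ->] : digit_expansions int_set a x.
  by exists p.
by rewrite hS; apply: digit_expansions1.
Qed.

(** Lifting all digits to polynomials turns an expansion into a polynomial relation at [a], whose
    value at 0 compares [p] with the lowest digit [d]. *)
Lemma lowest_digit (p : {poly int}) :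
  exists d q : {poly int}, evalZ d a \in S /\ evalZ (p - d - 'X * q) a = 0.
Proof.
have : digit_expansions int_set a (evalZ p a) by apply/digit_expansions_intP; exists p.
rewrite hS => -[n [f [fS pE]]].
have /fin_all_exists[g gE] j : exists q, evalZ q a = f j by apply/digits_in_intP/fS.
exists (g ord0), (\sum_(j < n) g (lift ord0 j) * 'X^j); split.
  by rewrite gE; apply: fS.
rewrite !evalZB pE big_ord_recl gE expr0 mulr1 [f ord0 + _]addrC addrK evalZM.
rewrite evalZ_sum mulr_sumr; apply/eqP; rewrite subr_eq0; apply/eqP.
apply: eq_bigr => j _; rewrite evalZM gE evalZXn -['X]expr1 evalZXn expr1.
by rewrite /= /bump /= add1n exprS mulrCA.
Qed.

(* Constant coefficients of lowest digits would otherwise be unbounded. *)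
Lemma digits_algebraic : algebraicOver (ratr : rat -> C) a.
Proof.
apply: contrapT => a_tr.
have evalZ_eq0 p : evalZ p a = 0 -> p = 0.
  move=> pa; apply: contrapT => /eqP nz_p; apply: a_tr.
  exists (map_poly intr p); last by apply/eqP; rewrite -evalZ_ratr.
  by rewrite map_poly_eq0_id0 // intr_eq0 lead_coef_eq0.
have /choice[d dP] (n : nat) : exists d, evalZ d a \in S /\ d.[0] = n%:Z.
  have [d [q [dS]]] := lowest_digit n%:Z%:P.
  move/evalZ_eq0/(congr1 (horner^~ 0)); rewrite !hornerE => /eqP.
  by rewrite subr_eq0 => /eqP dE; exists d.
apply: (@no_injective_nat_in_seq _ (fun n => evalZ (d n) a) S).
  move=> m n /eqP; rewrite -subr_eq0 -evalZB => /eqP/evalZ_eq0/eqP.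
  rewrite subr_eq0 => /eqP /(congr1 (horner^~ 0)).
  by rewrite (dP m).2 (dP n).2 => -[].
by move=> n; case: (dP n).
Qed.

Lemma card_digits_gt1 : (2 <= #|` S|)%N.
Proof.
have in_S (m : int) : digit_expansions [set` S] a m%:~R.
  by rewrite -hS; apply: digit_expansions1; exists m.
rewrite ltnNge; apply/negP; rewrite leq_eqVlt ltnS leqn0 => /orP[]; last first.
  by rewrite cardfs_eq0 => /eqP S0; have [n [f [/(_ ord0)]]] := in_S 0; rewrite /= S0.
case/cardfs1P=> c Sc; pose G n := \sum_(j < n) a ^+ j.
have intE (m : int) : exists n, m%:~R = c * G n.+1.
  have [n [f [fS ->]]] := in_S m; exists n; rewrite mulr_sumr.
  by apply: eq_bigr => j _; have := fS j; rewrite /= Sc => /fset1P ->.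
have c_neq0 : c != 0.
  by apply/eqP => c0; have [n /eqP] := intE 1; rewrite c0 mul0r oner_eq0.
have [k /esym/eqP] := intE 0; rewrite mulf_eq0 (negPf c_neq0) /= => /eqP Gk.
(* As [G k.+1 = 0], lengthening a geometric sum by [k.+1] terms does not change it. *)
have G_period n : G (n + k.+1)%N = G n.
  rewrite /G big_split_ord /= -[RHS]addr0; congr (_ + _).
  under eq_bigr do rewrite exprD.
  by rewrite -mulr_sumr -/(G _) Gk mulr0.
have G_mod n : G n = G (n %% k.+1)%N.
  rewrite {1}(divn_eq n k.+1); elim: (n %/ k.+1)%N => [|q IH]; first by rewrite mul0n.
  by rewrite mulSn -addnA addnC G_period.
apply: (@no_injective_nat_in_seq _ (fun n => n%:R : C) [seq c * G i | i <- iota 0 k.+1]).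
  by move=> m n /eqP; rewrite eqr_nat => /eqP.
move=> n; have [m] := intE n; rewrite G_mod -pmulrn => ->.
by apply/mapP; exists (m.+1 %% k.+1)%N; rewrite ?mem_iota ?ltn_mod.
Qed.

Lemma digits_residues (M : {poly int}) : is_primitive_minpoly a M ->
  exists P : 'I_(`|M.[0]|%N) -> {poly int},
    injective (fun j => evalZ (P j) a) /\
    forall j, evalZ (P j) a \in S /\ ((P j).[0] = j%:Z %[mod M.[0]])%Z.
Proof.
move=> hM.
have dvd0 p : evalZ p a = 0 -> (M.[0] %| p.[0])%Z.
  by case/(primitive_minpoly_dvd _ _ _ _ hM)=> q ->; rewrite hornerM dvdz_mulr.
have /fin_all_exists[P PP] (j : 'I_(`|M.[0]|%N)) : exists d,
    evalZ d a \in S /\ (d.[0] = j%:Z %[mod M.[0]])%Z.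
  have [d [q [dS /dvd0]]] := lowest_digit j%:Z%:P.
  rewrite !hornerE -eqz_mod_dvd => /eqP dE; exists d; split=> //.
exists P; split=> // i j /= /eqP; rewrite -subr_eq0 -evalZB => /eqP/dvd0.
(* Equal values force [i] and [j] to be congruent modulo [M.[0]]; both lie below its absolute value,
   so they coincide. *)
rewrite hornerD hornerN -eqz_mod_dvd (PP i).2 (PP j).2 -!(modz_abs _ M.[0]).
rewrite !modz_small ?ltz_nat ?ltn_ord //.
by case/eqP => /val_inj.
Qed.

Lemma integer_digits (rep : C -> {poly int}) s :
  (forall x, x \in S -> evalZ (rep x) a = x) ->
  (forall x, x \in S -> (size (rep x) <= s.+1)%N) ->
  exists2 F : {fset int},
    digit_expansions int_set a
      = digit_expansions ((fun m : int => m%:~R) @` [set` F]) a &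
    (#|` F| <= \sum_(n < s.+1) #|` S| ^ n.+1)%N.
Proof.
move=> repE rep_size; pose c x k := (rep x)`_k.
pose W := flatten [seq window_sums c S s n.+1 | n <- iota 0 s.+1].
exists [fset m in W]%fset; last first.
  rewrite card_fseq (leq_trans (size_undup _)) // size_flatten /shape -map_comp.
  rewrite sumnE big_map -[iota _ _]/(index_iota 0 s.+1) big_mkord eq_leq //.
  by apply: eq_bigr => n _; apply: size_window_sums.
have [x0 x0S] : exists x0, x0 \in S.
  by apply/fset0Pn; rewrite -cardfs_gt0 (leq_trans _ card_digits_gt1).
apply/seteqP; split=> [z /digit_expansions_intP[r ->]|z [n [f [fF ->]]]]; last first.
  by exists n, f; split=> // j; have [m _ <-] := fF j; exists m.
(* Prepending [s] copies of [x0] makes every window complete on the low side;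
   dropping the [s] lowest coefficients then costs the fixed summand [k]. *)
pose k := drop_poly s (\sum_(i < s) rep x0 * 'X^i).
(* Expanding [r - k] instead of [r] compensates for the summand [k] added by the padding. *)
have : digit_expansions int_set a (evalZ (r - k) a).
  by apply/digit_expansions_intP; exists (r - k).
rewrite hS => -[n [f [fS rkE]]].
(* Past [s + n] the default of [inord] yields some digit of [S]; no window reaches that far. *)
pose h i := if (i < s)%N then x0 else f (inord (i - s)).
have hS' i : h i \in S by rewrite /h; case: ifP => // _; apply: fS.
pose Q := \sum_(i < s + n.+1) rep (h i) * 'X^i.
pose D := drop_poly s Q.
have DE : D = k + \sum_(j < n.+1) rep (f j) * 'X^j.
  rewrite /D /Q big_split_ord /= drop_polyD; congr (_ + _).
    by congr drop_poly; apply: eq_bigr => i _; rewrite /h ltn_ord.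
  rewrite -[RHS](drop_polyMXn_id s) mulr_suml; congr drop_poly.
  apply: eq_bigr => j _; rewrite /h ltnNge leq_addr /= addKn inord_val.
  by rewrite exprD mulrA mulrAC.
have rE : evalZ r a = evalZ D a.
  rewrite DE evalZD evalZ_sum -[LHS](subrK (evalZ k a)) -evalZB rkE addrC.
  by congr (_ + _); apply: eq_bigr => j _; rewrite evalZM evalZXn repE //; apply: fS.
have D_window m : D`_m =
    \sum_(t < minn s.+1 (s + n.+1 - m)) c (h (m + t)%N) (s - t)%N.
  rewrite coef_drop_poly; apply: (@coef_convolution_window s n m (rep \o h)).
  by move=> i; apply: rep_size.
have D_size : (size D <= (s + n).+1)%N.
  apply/leq_sizeP => m lt_m; rewrite D_window (_ : _ - m = 0)%N ?minn0 ?big_ord0 //.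
  by apply/eqP; rewrite subn_eq0 addnS.
rewrite rE (evalZ_coef_wide _ _ _ _ D_size).
exists (s + n)%N, (fun j => (D`_j)%:~R); split=> // j; exists D`_j => //.
suff : D`_j \in W by move=> DW; rewrite /mkset in_fset.
rewrite D_window; set L := minn _ _.
(* Up to the degree bound windows are nonempty, so their lengths are among the [1, ..., s+1] listed
   in [W]. *)
have L_gt0 : (0 < L)%N by rewrite leq_min /= subn_gt0 addnS ltn_ord.
apply/flattenP; exists (window_sums c S s L).
  apply/mapP; exists L.-1; last by rewrite prednK.
  by rewrite mem_iota add0n prednK // geq_minl.
exact: (@mem_window_sums _ c S s L (fun t => h (j + t)%N)).
Qed.

End Digits.

Theorem theorem1 (R : realType) (a : R[i]) (S : {fset R[i]})
    (hS : digit_expansions int_set a = digit_expansions [set` S] a) :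
  [/\ algebraicOver (ratr : rat -> R[i]) a,
      [set` S] `<=` digit_expansions int_set a,
      (forall rep : R[i] -> {poly int},
         (forall x, x \in S -> evalZ (rep x) a = x) ->
         let s := (\max_(x <- S) (size (rep x)).-1)%N in
         exists F : {fset int},
           digit_expansions int_set a
             = digit_expansions ((fun m : int => m%:~R) @` [set` F]) a /\
           (#|` F|%:R : rat) <=
             #|` S|%:R * ((#|` S|%:R ^+ s.+1 - 1) / (#|` S|%:R - 1))),
      (2 <= #|` S|)%N &
      forall M : {poly int}, is_primitive_minpoly a M ->
        exists P : 'I_(`|M.[0]|%N) -> {poly int},
          injective (fun j => evalZ (P j) a) /\
          forall j, evalZ (P j) a \in S /\
            ((P j).[0] = j%:Z %[mod M.[0]])%Z].
Proof.
split.
- exact: digits_algebraic hS.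
- by move=> x Sx; rewrite hS; apply: digit_expansions1.
- move=> rep repE s.
  have rep_size x : x \in S -> (size (rep x) <= s.+1)%N.
    (* [leqSpred] covers the zero polynomial too, whose size is 0. *)
    move=> Sx; apply: leq_trans (leqSpred _) _; rewrite ltnS.
    exact: (@leq_bigmax_seq _ _ xpredT (fun y => (size (rep y)).-1)).
  have [F FE cardF] := integer_digits _ _ _ hS rep s repE rep_size.
  exists F; split=> //.
  have S1 : (#|` S|%:R - 1 : rat) != 0.
    by rewrite subr_eq0 pnatr_eq1 gtn_eqF // (card_digits_gt1 _ _ _ hS).
  rewrite subrX1 [_ / _]mulrAC divff // mul1r mulr_sumr.
  rewrite (le_trans (y := (\sum_(n < s.+1) #|` S| ^ n.+1)%N%:R)) ?ler_nat //.
  by rewrite natr_sum ler_sum // => n _; rewrite natrX exprS.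
- exact: card_digits_gt1 hS.
- by move=> M; apply: digits_residues hS M.
Qed.
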